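(* Let $\varepsilon\in\{1,-1\}$, let $k\ge1$ be an integer, and let $A_{k-1}(n)=a_{k-1}n^{k-1}+\cdots+a_1n+a_0$ be a polynomial with integer coefficients satisfying the identity $$(n+1)A_{k-1}(n+1)-\varepsilon A_{k-1}(n)=n^k+A_{k-1}(1)-\varepsilon A_{k-1}(0)\quad\text{for all integers } n\ge0.$$ Then for every integer $n\ge1$, $$\sum_{i=0}^{n-1}\varepsilon^i\,i!\,\bigl[i^k+A_{k-1}(1)-\varepsilon A_{k-1}(0)\bigr]\equiv-\varepsilon A_{k-1}(0)\pmod{n!}.$$ *)

(* Defs.v *)
From mathcomp Require Export all_boot all_order all_algebra.

(* Main.v *)
Require Import Defs.
From mathcomp Require Import all_boot all_order all_algebra.
From mathcomp Require Import ring.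
Import Order.TTheory GRing.Theory Num.Theory.
Local Open Scope ring_scope.

(** The sum telescopes. Multiplying the functional equation at [i] by
    [eps ^+ i * i`!] turns its left-hand side into [u (i + 1) - u i], where
    [u i = eps ^+ i.+1 * i`! * A.[i]]: the factor [i + 1] completes the
    factorial, and [eps ^+ 2 = 1] supplies the two missing powers of [eps].
    The sum is therefore exactly [u n - u 0], in which [u n] is a multiple of
    [n`!] and [u 0 = eps * A.[0]]. *)

(** Each summand is a difference of consecutive terms of
    [eps ^+ i.+1 * i`! * a i]; below, [a] is the sequence of values of the
    polynomial at the naturals. *)
Lemma sum_sign_fact_telescope (R : comPzRingType) (eps : R) (a : nat -> R)
    (n : nat) :
  eps ^+ 2 = 1 ->
  \sum_(0 <= i < n) eps ^+ i * (i`!)%:R * (i.+1%:R * a i.+1 - eps * a i)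
  = eps ^+ n.+1 * (n`!)%:R * a n - eps * a 0%N.
Proof.
move=> eps2.
rewrite (telescope_sumr_eq (fun i => eps ^+ i.+1 * (i`!)%:R * a i)) //.
  by rewrite fact0 expr1 mulr1.
move=> i _; rewrite factS natrM.
have -> : eps ^+ i.+2 = eps ^+ i by rewrite -addn2 exprD eps2 mulr1.
by rewrite exprS; ring.
Qed.

Theorem proposition1
  (eps : int) (heps : eps = 1 \/ eps = -1)
  (k : nat) (hk : (1 <= k)%N)
  (A : {poly int}) (hA : (size A <= k)%N)
  (hid : forall n : nat,
     (n%:Z + 1) * A.[n%:Z + 1] - eps * A.[n%:Z]
     = n%:Z ^+ k + A.[1] - eps * A.[0])
  (n : nat) (hn : (1 <= n)%N) :
  (\sum_(0 <= i < n) eps ^+ i * (i`!)%:Z * (i%:Z ^+ k + A.[1] - eps * A.[0])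
   = - (eps * A.[0]) %[mod (n`!)%:Z])%Z.
Proof.
have eps2 : eps ^+ 2 = 1 by case: heps => ->.
have -> : \sum_(0 <= i < n)
      eps ^+ i * (i`!)%:Z * (i%:Z ^+ k + A.[1] - eps * A.[0])
    = eps ^+ n.+1 * (n`!)%:Z * A.[n%:Z] - eps * A.[0].
  have := @sum_sign_fact_telescope int eps (fun i => A.[i%:Z]) n eps2.
  rewrite natz => <-; apply: eq_bigr => i _.
  by rewrite -hid !natz -addn1 PoszD.
by rewrite mulrAC modzMDl.
Qed.
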